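(* Let $0<\theta<1$. There exists an effective constant $C_{\theta} > 0$, depending only on $\theta$, such that for every $\alpha \in \mathbb{R}$ and every $n\in\mathbb{N}$, $$\min_{1 \leq a \leq n}\|a^{\theta}-\alpha\| \leq C_{\theta}\cdot n^{\theta-1},$$ where the minimum is over integers $a$.
   Context: $\mathbb{N}=\{1,2,\ldots\}$. For real $x$, $\|x\| := \min_{m\in\mathbb{Z}}|x-m|$ denotes the distance to the nearest integer. ''Effective'' means that the constant can in principle be computed explicitly. *)

(* Defs.v *)
From HB Require Import structures.
From mathcomp Require Import all_boot all_order all_algebra.
From mathcomp Require Import all_classical all_reals all_analysis.

Set Implicit Arguments.
Unset Strict Implicit.
Unset Printing Implicit Defensive.

Import Order.TTheory GRing.Theory Num.Theory.

Local Open Scope classical_set_scope.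
Local Open Scope ring_scope.

(* ||x||; the infimum is attained, so it is the minimum over the integers. *)
Definition dist_int (R : realType) (x : R) : R :=
  inf [set `|x - m%:~R| | m in [set: int]].

(* Meaningful for n >= 1: the default value F 1 is then one of the terms. *)
Definition min_upto (R : realType) (n : nat) (F : nat -> R) : R :=
  \big[Num.min/F 1%N]_(1 <= a < n.+1) F a.

(* Total recursive functions in Kleene's sense: the least class containing the
   initial functions and closed under composition, primitive recursion and
   minimization of functions having a zero for every value of the parameters
   (so that only total functions occur). *)
Inductive recursive : forall k : nat, (k.-tuple nat -> nat) -> Prop :=
| rec_zero k : @recursive k (fun _ => 0%N)
| rec_succ : @recursive 1 (fun v => (tnth v ord0).+1)
| rec_proj k (i : 'I_k) : @recursive k (fun v => tnth v i)
| rec_comp k l (f : l.-tuple nat -> nat) (g : 'I_l -> k.-tuple nat -> nat) :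
    recursive f -> (forall i, recursive (g i)) ->
    @recursive k (fun v => f [tuple g i v | i < l])
| rec_primrec k (g : k.-tuple nat -> nat) (h : k.+2.-tuple nat -> nat)
    (f : k.+1.-tuple nat -> nat) :
    recursive g -> recursive h ->
    (forall v : k.-tuple nat, f [tuple of 0%N :: v] = g v) ->
    (forall (v : k.-tuple nat) (n : nat), f [tuple of n.+1 :: v] =
       h [tuple of n :: f [tuple of n :: v] :: v]) ->
    recursive f
| rec_min k (f : k.+1.-tuple nat -> nat) (g : k.-tuple nat -> nat) :
    recursive f ->
    (forall v : k.-tuple nat, f [tuple of g v :: v] = 0%N) ->
    (forall (v : k.-tuple nat) (m : nat),
       (m < g v)%N -> f [tuple of m :: v] <> 0%N) ->
    recursive g.

(* Grzegorczyk's notion of a computable real function, for the domain (0, 1):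
   - the value at a rational p / q is approximated to within 2^-m by the
     rational (a - b) / (c + 1), with a, b, c recursive in p, q, m;
   - there is a modulus of uniform continuity d(k, m), recursive in the
     accuracy m and in the index k of the compact interval
     [1/(k+2), 1 - 1/(k+2)]; these intervals exhaust (0, 1). *)
Definition computable_on_unit_interval (R : realType) (F : R -> R) : Prop :=
  (exists a b c : 3.-tuple nat -> nat,
     [/\ recursive a, recursive b, recursive c &
      forall p q m : nat, (0 < p < q)%N ->
        let v := [tuple p; q; m] in
        `|F (p%:R / q%:R) - ((a v)%:R - (b v)%:R) / (c v).+1%:R| <= 2 ^- m]) /\
  (exists d : 2.-tuple nat -> nat,
     recursive d /\
     forall (k m : nat) (x y : R),
       k.+2%:R^-1 <= x <= 1 - k.+2%:R^-1 ->
       k.+2%:R^-1 <= y <= 1 - k.+2%:R^-1 ->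
       `|x - y| <= 2 ^- d [tuple k; m] ->
       `|F x - F y| <= 2 ^- m).

(* Main.v *)
Require Import Defs.
From HB Require Import structures.
From mathcomp Require Import all_boot all_order all_algebra.
From mathcomp Require Import all_classical all_reals all_analysis.
From mathcomp Require Import ring lra zify.

Import Order.TTheory GRing.Theory Num.Theory.

Local Open Scope ring_scope.

(** Put t = 1 / theta. The inequality holds with the constant 2 ^ t. If
    n ^ theta < 2, then n ^ (1 - theta) <= n < 2 ^ t, so that the right-hand
    side exceeds 1 and a = 1 will do. If n ^ theta >= 2, some translate b of
    alpha by an integer lies in ]n ^ theta - 1, n ^ theta], hence in
    [n ^ theta / 2, n ^ theta]. Take for a the integer part of the point
    y = b ^ t at which the power function takes the value b. Then a <= n, and
    b - a ^ theta is at most the increment of the power function over an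
    interval of length at most 1 starting at a >= y / 2 >= n / 2 ^ (t + 1), that
    is, at most a ^ (theta - 1) <= 2 ^ t * n ^ (theta - 1)
    ([root_floor_approx], [min_dist_powR_le]).

    For effectivity, 2 ^ t is replaced by a larger function of theta, the sum
    over k >= 0 of 2 ^ (k + 2) * max (0, t - k). Only the terms with k < t
    count, so it is locally a finite sum. It dominates 2 ^ t
    ([gap_const_ge]); at theta = p / q it is exactly a rational number with
    denominator p whose numerator is a sum of products of powers of 2 with
    truncated differences q - p * k, visibly primitive recursive
    ([gap_const_rational], [recursive_gap_const_numerator]); and it is
    Lipschitz on [1 / N, +oo[ with an explicit constant
    ([gap_const_lipschitz]), which gives a recursive modulus of continuity. *)

(** * Closure properties of the recursive functions *)

Definition tail_tuple k (w : k.+1.-tuple nat) : k.-tuple nat :=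
  [tuple tnth w (lift ord0 i) | i < k].

Lemma tail_tuple_cons k n (v : k.-tuple nat) :
  tail_tuple k [tuple of n :: v] = v.
Proof. by apply: eq_from_tnth => i; rewrite tnth_mktuple tnthS. Qed.

Lemma recursive_reindex k l (s : 'I_l -> 'I_k) (f : l.-tuple nat -> nat) :
  recursive f ->
  recursive (fun v : k.-tuple nat => f [tuple tnth v (s i) | i < l]).
Proof.
move=> rf; apply: (@rec_comp k l f (fun i v => tnth v (s i))) => // i.
exact: rec_proj.
Qed.

(** Evaluating the first variable at a function of the others. This lets the
    closure properties below be stated for arbitrary arguments, and not only
    for the operations as functions of tuples of variables. *)
Lemma recursive_subst k (F : nat -> k.-tuple nat -> nat)
    (e : k.-tuple nat -> nat) :
  recursive (fun w : k.+1.-tuple nat => F (tnth w ord0) (tail_tuple k w)) ->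
  recursive e -> recursive (fun v => F (e v) v).
Proof.
move=> rF re.
pose g (i : 'I_k.+1) (v : k.-tuple nat) :=
  if unlift ord0 i is Some j then tnth v j else e v.
have rg i : recursive (g i).
  by rewrite /g; case: (unlift ord0 i) => [j|] //; exact: rec_proj.
have := @rec_comp k k.+1 _ g rF rg.
congr recursive; apply: funext => v.
congr F; first by rewrite tnth_mktuple /g unlift_none.
by apply: eq_from_tnth => i; rewrite !tnth_mktuple /g liftK.
Qed.

Lemma recursive_primrec k (F : nat -> k.-tuple nat -> nat)
    (h : k.+2.-tuple nat -> nat) (e : k.-tuple nat -> nat) :
  recursive (F 0%N) -> recursive h ->
  (forall n v, F n.+1 v = h [tuple of n :: F n v :: v]) ->
  recursive e -> recursive (fun v => F (e v) v).
Proof.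
move=> r0 rh Fh; apply: recursive_subst.
by apply: (rec_primrec r0 rh) => [v|v n]; rewrite !tnth0 !tail_tuple_cons.
Qed.

Lemma recursive_succ k (f : k.-tuple nat -> nat) :
  recursive f -> recursive (fun v => (f v).+1).
Proof.
move=> rf; have := @rec_comp k 1 _ (fun _ => f) rec_succ (fun _ => rf).
by congr recursive; apply: funext => v; rewrite tnth_mktuple.
Qed.

Lemma recursive_cst k n : recursive (fun _ : k.-tuple nat => n).
Proof. by elim: n => [|n]; [exact: rec_zero | exact: recursive_succ]. Qed.

Lemma recursive_pred k (f : k.-tuple nat -> nat) :
  recursive f -> recursive (fun v => (f v).-1).
Proof.
apply: (recursive_primrec _ (fun n _ => n.-1) (fun w => tnth w ord0)).
- exact: rec_zero.
- exact: rec_proj.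
- by move=> n v; rewrite tnth0.
Qed.

Lemma recursive_add k (f g : k.-tuple nat -> nat) :
  recursive f -> recursive g -> recursive (fun v => f v + g v)%N.
Proof.
move=> rf; apply: (recursive_primrec _ (fun n v => f v + n)%N
  (fun w => (tnth w (lift ord0 ord0)).+1)).
- by move: rf; congr recursive; apply: funext => v; rewrite addn0.
- exact/recursive_succ/rec_proj.
- by move=> n v; rewrite tnthS tnth0 addnS.
Qed.

Lemma recursive_sub k (f g : k.-tuple nat -> nat) :
  recursive f -> recursive g -> recursive (fun v => f v - g v)%N.
Proof.
move=> rf; apply: (recursive_primrec _ (fun n v => f v - n)%N
  (fun w => (tnth w (lift ord0 ord0)).-1)).
- by move: rf; congr recursive; apply: funext => v; rewrite subn0.
- exact/recursive_pred/rec_proj.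
- by move=> n v; rewrite tnthS tnth0 subnS.
Qed.

Lemma recursive_exp2 k (f : k.-tuple nat -> nat) :
  recursive f -> recursive (fun v => 2 ^ f v)%N.
Proof.
apply: (recursive_primrec _ (fun n _ => 2 ^ n)%N
  (fun w => tnth w (lift ord0 ord0) + tnth w (lift ord0 ord0))%N).
- exact: recursive_cst.
- by apply: recursive_add; exact: rec_proj.
- by move=> n v; rewrite tnthS tnth0 expnS mul2n addnn.
Qed.

Lemma recursive_sum k (f : nat -> k.-tuple nat -> nat)
    (e : k.-tuple nat -> nat) :
  recursive (fun w : k.+1.-tuple nat => f (tnth w ord0) (tail_tuple k w)) ->
  recursive e -> recursive (fun v => \sum_(j < e v) f j v)%N.
Proof.
move=> rf.
(* The step function receives the index, the partial sum and the parameters;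
   s discards the partial sum before f is applied. *)
pose s (i : 'I_k.+1) : 'I_k.+2 :=
  if unlift ord0 i is Some j then lift ord0 (lift ord0 j) else ord0.
apply: (recursive_primrec _ (fun n v => \sum_(j < n) f j v)%N
  (fun w => tnth w (lift ord0 ord0) +
            f (tnth w ord0) (tail_tuple k (tail_tuple k.+1 w)))%N).
- move: (rec_zero k); congr recursive; apply: funext => v.
  by rewrite big_ord0.
- apply: recursive_add; first exact: rec_proj.
  move: (recursive_reindex _ _ s _ rf); congr recursive; apply: funext => w.
  congr f; first by rewrite tnth_mktuple /s unlift_none.
  by apply: eq_from_tnth => i; rewrite !tnth_mktuple /s liftK.
- move=> n v; rewrite big_ord_recr /= tnthS !tnth0.
  have -> := tail_tuple_cons k.+1 n [tuple of (\sum_(j < n) f j v)%N :: v].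
  by rewrite tail_tuple_cons.
Qed.

Lemma recursive_mul k (f g : k.-tuple nat -> nat) :
  recursive f -> recursive g -> recursive (fun v => f v * g v)%N.
Proof.
move=> rf rg; have : recursive (fun v => \sum_(j < f v) g v)%N.
  by apply: (recursive_sum _ (fun _ v => g v)) => //; exact: recursive_reindex.
by congr recursive; apply: funext => v; rewrite sum_nat_const card_ord.
Qed.

(** * The constant and its computability *)

Definition ramp_sum (R : realType) (N : nat) (t : R) : R :=
  \sum_(k < N) 2 ^+ k.+2 * Num.max 0 (t - k%:R).

(** The infinite sum of the ramps at t = 1 / theta, cut just after the last
    index that can contribute. *)
Definition gap_const (R : realType) (theta : R) : R :=
  ramp_sum R (Num.truncn theta^-1).+1 theta^-1.

Lemma ramp_sum_widen (R : realType) (M N : nat) (t : R) :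
  t <= M%:R -> (M <= N)%N -> ramp_sum R N t = ramp_sum R M t.
Proof.
move=> tM /subnKC <-; elim: (N - M)%N => [|d <-]; first by rewrite addn0.
rewrite addnS /ramp_sum big_ord_recr /= max_l ?mulr0 ?addr0 //.
by rewrite subr_le0 (le_trans tM) // ler_nat leq_addr.
Qed.

(** The cut-off can be any integer above 1 / theta; choosing it uniformly for
    two points, or equal to q at p / q, removes the integer part from all
    computations. *)
Lemma gap_constE (R : realType) (N : nat) (theta : R) :
  theta^-1 <= N%:R -> gap_const R theta = ramp_sum R N theta^-1.
Proof.
move=> tN; set M := (Num.truncn theta^-1).+1.
have tM : theta^-1 <= M%:R by apply/ltW/truncnS_gt.
rewrite -(ramp_sum_widen R N (maxn M N)) ?leq_maxr //.
by rewrite (ramp_sum_widen R M) ?leq_maxl.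
Qed.

(** Each ramp is 1-Lipschitz, and the coefficients add up to less than
    2 ^ (N + 2). *)
Lemma ramp_sum_lipschitz (R : realType) (N : nat) (s t : R) :
  `|ramp_sum R N s - ramp_sum R N t| <= 2 ^+ N.+2 * `|s - t|.
Proof.
elim: N => [|N IH].
  by rewrite /ramp_sum !big_ord0 subr0 normr0 mulr_ge0.
rewrite /ramp_sum !big_ord_recr /= opprD addrACA -mulrBr.
apply: le_trans (ler_normD _ _) _.
rewrite (exprS _ N.+2) mulr2n mulrDl mul1r [leRHS]mulrDl lerD //.
rewrite normrM ger0_norm ?exprn_ge0 // ler_wpM2l ?exprn_ge0 //.
(* The positive part is nonexpansive. *)
have := ler_norm (s - t); have := ler_norm (t - s); rewrite (distrC t s).
by rewrite ler_norml; case: (lerP 0 (s - _)); case: (lerP 0 (t - _)); lra.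
Qed.

(** The positive part of q / p - k is the truncated difference q - p * k of
    natural numbers, divided by p. *)
Lemma gap_const_rational (R : realType) (p q : nat) : (0 < p)%N ->
  gap_const R (p%:R / q%:R) =
  (\sum_(k < q) 2 ^ k.+2 * (q - p * k))%N%:R / p%:R.
Proof.
move=> p_gt0; have p0 : (p%:R : R) != 0 by rewrite pnatr_eq0 -lt0n.
have qp_le : (p%:R / q%:R : R)^-1 <= q%:R.
  by rewrite invf_div ler_pdivrMr ?ltr0n // -natrM ler_nat leq_pmulr.
rewrite (gap_constE _ _ _ qp_le) /ramp_sum natr_sum mulr_suml.
apply: eq_bigr => k _; rewrite natrM natrX -mulrA invf_div.
congr (_ * _); have -> : q%:R / p%:R - k%:R = (q%:R - p%:R * k%:R) / p%:R :> R.
  by field.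
rewrite -natrM; case: (leqP (p * k) q) => pkq.
  by rewrite natrB // max_r // divr_ge0 // subr_ge0 ler_nat.
rewrite max_l; last first.
  by rewrite pmulr_lle0 ?invr_gt0 ?ltr0n // subr_le0 ler_nat ltnW.
by rewrite (eqP (ltnW pkq)) mul0r.
Qed.

Lemma recursive_gap_const_numerator :
  recursive (fun v : 3.-tuple nat =>
    \sum_(k < tnth v (lift ord0 ord0))
       2 ^ k.+2 * (tnth v (lift ord0 ord0) - tnth v ord0 * k))%N.
Proof.
apply: (recursive_sum 3 (fun k v =>
  2 ^ k.+2 * (tnth v (lift ord0 ord0) - tnth v ord0 * k))%N);
  last exact: rec_proj.
have rt i : recursive (fun w : 4.-tuple nat => tnth (tail_tuple 3 w) i).
  have := rec_proj (lift ord0 i : 'I_4).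
  by congr recursive; apply: funext => w; rewrite tnth_mktuple.
apply: recursive_mul.
  exact/recursive_exp2/recursive_succ/recursive_succ/rec_proj.
by apply: recursive_sub => //; apply: recursive_mul => //; exact: rec_proj.
Qed.

Lemma inv_lipschitz (R : realType) (e x y : R) : 0 < e -> e <= x -> e <= y ->
  `|x^-1 - y^-1| <= e ^- 2 * `|x - y|.
Proof.
move=> e0 ex ey; have x0 := lt_le_trans e0 ex; have y0 := lt_le_trans e0 ey.
have -> : x^-1 - y^-1 = (x * y)^-1 * (y - x) by field; rewrite !gt_eqF.
rewrite normrM distrC ger0_norm ?invr_ge0 ?mulr_ge0 ?(ltW x0) ?(ltW y0) //.
rewrite ler_wpM2r // lef_pV2 ?posrE ?exprn_gt0 ?mulr_gt0 // expr2.
by rewrite ler_pM // (ltW e0).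
Qed.

(** The inverse contributes N ^ 2 <= 2 ^ (2 * N) and the ramps 2 ^ (N + 2) to
    the Lipschitz constant; a power of 2 turns into a modulus by adding
    exponents. *)
Lemma gap_const_lipschitz (R : realType) (N : nat) (x y : R) : (0 < N)%N ->
  N%:R^-1 <= x -> N%:R^-1 <= y ->
  `|gap_const R x - gap_const R y| <= 2 ^+ (3 * N + 2) * `|x - y|.
Proof.
move=> N_gt0 Nx Ny; have N0 : 0 < N%:R^-1 :> R by rewrite invr_gt0 ltr0n.
have inv_le (z : R) : N%:R^-1 <= z -> z^-1 <= N%:R.
  by move=> Nz; rewrite invf_ple ?posrE ?ltr0n // (lt_le_trans N0).
rewrite !(gap_constE _ N) ?inv_le //.
apply: le_trans (ramp_sum_lipschitz _ _ _ _) _.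
have -> : (3 * N + 2 = N.+2 + (N + N))%N by lia.
rewrite exprD -mulrA ler_wpM2l ?exprn_ge0 //.
apply: le_trans (inv_lipschitz _ _ _ _ N0 Nx Ny) _.
rewrite ler_wpM2r // exprVn invrK expr2 exprD -!natrX -!natrM ler_nat.
by rewrite leq_mul // ltnW // ltn_expl.
Qed.

Lemma gap_const_computable (R : realType) :
  computable_on_unit_interval (gap_const R).
Proof.
split.
  exists (fun v => \sum_(k < tnth v (lift ord0 ord0))
       2 ^ k.+2 * (tnth v (lift ord0 ord0) - tnth v ord0 * k))%N.
  exists (fun _ => 0%N), (fun v => (tnth v ord0).-1); split.
  - exact: recursive_gap_const_numerator.
  - exact: rec_zero.
  - exact/recursive_pred/rec_proj.
  move=> p q m /andP[p0 _] /=.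
  rewrite !(tnth_nth 0%N) /= prednK // subr0 gap_const_rational //.
  by rewrite subrr normr0 invr_ge0 exprn_ge0.
exists (fun v => tnth v (lift ord0 ord0) + (3 * (tnth v ord0).+2 + 2))%N; split.
  apply: recursive_add; first exact: rec_proj.
  apply: recursive_add; last exact: recursive_cst.
  apply: recursive_mul; first exact: recursive_cst.
  exact/recursive_succ/recursive_succ/rec_proj.
move=> k m x y /andP[kx _] /andP[ky _]; rewrite !(tnth_nth 0%N) /= => xy.
apply: le_trans (gap_const_lipschitz _ _ _ _ (ltn0Sn k.+1) kx ky) _.
have -> : 2 ^- m = 2 ^+ (3 * k.+2 + 2) * 2 ^- (m + (3 * k.+2 + 2)) :> R.
  by rewrite (exprD _ m) invfM mulrCA divff ?mulr1 // expf_neq0 // pnatr_eq0.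
by rewrite ler_wpM2l ?exprn_ge0.
Qed.

(** Let m + 1 be the integer part of t = 1 / theta, which is at least 1. The
    ramp of index m alone has value t - m >= 1 and coefficient 2 ^ (m + 2), and
    t < m + 2. *)
Lemma gap_const_ge (R : realType) (theta : R) : 0 < theta < 1 ->
  2 `^ theta^-1 <= gap_const R theta.
Proof.
move=> /andP[th0 th1]; set t := theta^-1.
have t1 : 1 < t by rewrite invf_gt1.
have /andP[mt tm] : (Num.truncn t)%:R <= t < (Num.truncn t).+1%:R.
  by apply: truncn_itv; lra.
have m0 : (0 < Num.truncn t)%N.
  by rewrite -ltnS -(ltr_nat R); apply: lt_trans tm.
rewrite /gap_const -/t; move: m0 mt tm; case: (Num.truncn t) => // m _ mt tm.
rewrite /ramp_sum big_ord_recr /= big_ord_recr /=.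
have ramp_ge0 k : 0 <= 2 ^+ k.+2 * Num.max 0 (t - k%:R).
  by rewrite mulr_ge0 ?exprn_ge0 // le_max lexx.
apply: le_trans (_ : 2 ^+ m.+2 <= _).
  by rewrite -powR_mulrn // ler_powR ?ler1n // ltW.
rewrite -[leLHS]addr0 lerD //.
rewrite -[leLHS]add0r lerD //.
  by apply: sumr_ge0.
rewrite ler_peMr ?exprn_ge0 // le_max; apply/orP; right.
by move: mt; rewrite -natr1; lra.
Qed.

(** * Distance to the nearest integer along the powers *)

Lemma dist_int_le (R : realType) (x : R) (m : int) : dist_int x <= `|x - m%:~R|.
Proof.
by apply: ge_inf; [exists 0 => _ [j _ <-] | exists m].
Qed.

Lemma dist_int_le1 (R : realType) (x : R) : dist_int x <= 1.
Proof.
apply: le_trans (dist_int_le R x (Num.floor x)) _.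
by have := floor_itv x; rewrite intrD => /andP[? ?]; rewrite ger0_norm; lra.
Qed.

Lemma min_upto_le (R : realType) (n a : nat) (F : nat -> R) :
  (1 <= a <= n)%N -> min_upto n F <= F a.
Proof.
by move=> an; apply: ge_bigmin_seq => //; rewrite mem_index_iota ltnS.
Qed.

Lemma ler_powRN (R : realType) (r x y : R) : r <= 0 -> 0 < x -> x <= y ->
  y `^ r <= x `^ r.
Proof.
move=> r0 x0 xy; rewrite -[r]opprK !(powRN _ (- r)).
have y0 := lt_le_trans x0 xy.
rewrite lef_pV2 ?posrE ?powR_gt0 //.
by apply: ge0_ler_powR; rewrite ?nnegrE ?oppr_ge0 ?(ltW x0) ?(ltW y0).
Qed.

(** A convenient substitute for the mean value theorem: writing u ^ theta as
    u * u ^ (theta - 1), the second factor decreases with u. *)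
Lemma powR_gap (R : realType) (theta x y : R) : 0 < theta < 1 ->
  0 < x -> x <= y -> y `^ theta - x `^ theta <= (y - x) * x `^ (theta - 1).
Proof.
move=> /andP[th0 th1] x0 xy.
rewrite -!(mulr_powRB1 _ th0) ?(ltW x0) ?(ltW (lt_le_trans x0 xy)) //.
rewrite mulrBl lerB // ler_wpM2l ?ler_powRN //; lra.
Qed.

(** The largest integer a at or before the point y with y ^ theta = b: since
    y >= 1, it satisfies y - a <= 1 and a >= y / 2, so the gap of the power
    function between a and y is controlled by (y / 2) ^ (theta - 1). *)
Lemma root_floor_approx (R : realType) (theta b : R) :
  0 < theta < 1 -> 1 <= b ->
  let a := Num.truncn (b `^ theta^-1) in
  (1 <= a)%N /\ `|a%:R `^ theta - b| <= (b `^ theta^-1 / 2) `^ (theta - 1).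
Proof.
move=> th b1; case/andP: (th) => th0 th1; set y := b `^ theta^-1 => a.
have y1 : 1 <= y.
  have := ler_powR b1 (ltW (_ : 0 < theta^-1)); rewrite powRr0; apply.
  by rewrite invr_gt0.
have yb : y `^ theta = b by rewrite -powRrM mulVf ?gt_eqF // powRr1 //; lra.
have /andP[ay ya] : a%:R <= y < a.+1%:R by apply: truncn_itv; lra.
have a1 : (1 <= a)%N by rewrite -ltnS -(ltr_nat R) (le_lt_trans y1).
split=> //; have a1R : 1 <= a%:R :> R by rewrite ler1n.
rewrite -natr1 in ya.
have ab : a%:R `^ theta <= b.
  by rewrite -yb; apply: ge0_ler_powR; rewrite ?nnegrE //; lra.
rewrite distrC ger0_norm ?subr_ge0 // -yb.
apply: le_trans (powR_gap _ _ _ _ th _ ay) _; first by lra.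
apply: le_trans (_ : a%:R `^ (theta - 1) <= _).
  rewrite ler_piMl ?powR_ge0 //; lra.
by apply: ler_powRN; lra.
Qed.

(** With t = 1 / theta and y = b ^ t, the bound y / 2 >= n * 2 ^ (- t - 1) is
    raised to the negative power theta - 1; the factor 2 ^ t appears because
    (- t - 1) * (theta - 1) = t - theta <= t. *)
Lemma min_dist_powR_le (R : realType) (theta alpha : R) (n : nat) :
  0 < theta < 1 -> (1 <= n)%N ->
  min_upto n (fun a : nat => dist_int (a%:R `^ theta - alpha))
    <= 2 `^ theta^-1 * n%:R `^ (theta - 1).
Proof.
move=> th n1; case/andP: (th) => th0 th1; set F := fun a => _.
have nR : 1 <= n%:R :> R by rewrite ler1n.
(* The threshold 2 ensures that every b in ]n ^ theta - 1, n ^ theta] satisfies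
   b >= 1 and b >= n ^ theta / 2. *)
case: (lerP 2 (n%:R `^ theta)) => [n_big|n_small]; last first.
  apply: le_trans (min_upto_le R n 1 F _) _; first by rewrite leqnn.
  apply: le_trans (dist_int_le1 R _) _.
  rewrite -[theta - 1]opprB powRN ler_pdivlMr ?mul1r; last first.
    by rewrite powR_gt0 //; lra.
  have n_lt : n%:R <= 2 `^ theta^-1.
    have -> : (n%:R : R) = (n%:R `^ theta) `^ theta^-1.
      by rewrite -powRrM divff ?gt_eqF // powRr1 //; lra.
    apply: ge0_ler_powR; rewrite ?nnegrE ?powR_ge0 ?invr_ge0 //; lra.
  by apply: le_trans n_lt; apply: ler1_powR => //; lra.
pose j := Num.floor (n%:R `^ theta - alpha); pose b := alpha + j%:~R.
have := floor_itv (n%:R `^ theta - alpha); rewrite -/j intrD => /andP[j1 j2].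
have b1 : 1 <= b by rewrite /b; lra.
have [] := root_floor_approx R theta b th b1; set y := b `^ theta^-1.
set a := Num.truncn y => a1 ab.
have t0 : 0 < theta^-1 by rewrite invr_gt0.
have nE : (n%:R : R) = (n%:R `^ theta) `^ theta^-1.
  by rewrite -powRrM divff ?gt_eqF // powRr1 //; lra.
have yn : y <= n%:R.
  by rewrite nE; apply: ge0_ler_powR; rewrite ?nnegrE /b ?powR_ge0 //; lra.
have ny : 2 `^ (- theta^-1) * n%:R <= y.
  rewrite powRN mulrC ler_pdivrMr ?powR_gt0 //.
  rewrite {1}nE -powRM //; last by lra.
  by apply: ge0_ler_powR; rewrite ?nnegrE ?powR_ge0 /b //; lra.
have an : (a <= n)%N.
  have y0 : 0 <= y by exact: powR_ge0.
  have /andP[ay _] := truncn_itv y0.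
  by rewrite -(ler_nat R) (le_trans ay).
apply: le_trans (min_upto_le R n a F _) _; first by rewrite a1.
apply: le_trans (dist_int_le R _ j) _.
have -> : a%:R `^ theta - alpha - j%:~R = a%:R `^ theta - b by rewrite /b; ring.
apply: le_trans ab _.
have lo : 0 < 2 `^ (- theta^-1 - 1) * n%:R.
  by rewrite mulr_gt0 ?powR_gt0 //; lra.
apply: le_trans (ler_powRN R (theta - 1) _ _ _ lo _) _; first by lra.
  rewrite powRD ?implybT ?pnatr_eq0 ?implybT // powR_inv1 //.
  rewrite mulrAC ler_wpM2r //.
rewrite powRM ?powR_ge0 // ler_wpM2r ?powR_ge0 // -powRrM.
apply: ler_powR; first by rewrite ler1n.
have -> : (- theta^-1 - 1) * (theta - 1) = theta^-1 - theta.
  by field; rewrite gt_eqF.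
lra.
Qed.

Theorem lemma1p2 (R : realType) :
  exists C : R -> R,
    computable_on_unit_interval C /\
    forall theta : R, 0 < theta < 1 ->
      0 < C theta /\
      forall (alpha : R) (n : nat), (1 <= n)%N ->
        min_upto n (fun a : nat => dist_int (a%:R `^ theta - alpha))
          <= C theta * n%:R `^ (theta - 1).
Proof.
exists (gap_const R); split; first exact: gap_const_computable.
move=> theta th; have C_ge := gap_const_ge R theta th.
split=> [|alpha n n1]; first by apply: lt_le_trans C_ge; rewrite powR_gt0.
apply: le_trans (min_dist_powR_le R theta alpha n th n1) _.
by rewrite ler_wpM2r ?powR_ge0.
Qed.
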